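(* Any CB-graph (graph with convex balls) $G$ has $G^2$-connected medians; that is, for every profile $\pi$ on $G$, the median set $\mathrm{Med}(\pi)$ induces a connected subgraph of $G^2$.
   Context: Graphs are undirected, connected, without loops or multiple edges, and not necessarily finite. $d$ is the standard graph distance of $G=(V,E)$. $G^2$ has vertex set $V$, and distinct $u,v$ are adjacent iff $d(u,v)\le 2$. A profile is a map $\pi:V\to[0,\infty)$ with finite support, $F_\pi(x)=\sum_{u}\pi(u)d(u,x)$, and $\mathrm{Med}(\pi)$ is the set of vertices minimizing $F_\pi$. A vertex set is convex if it contains $I(x,y)=\{w:d(x,w)+d(w,y)=d(x,y)\}$ for any two of its vertices $x,y$. A graph with convex balls (CB-graph) is a graph in which every ball $B_r(v)=\{x:d(v,x)\le r\}$ is convex. *)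

(* Defs.v *)
From HB Require Import structures.
From mathcomp Require Import all_boot all_order all_algebra.
From mathcomp Require Import all_classical all_reals.

Set Implicit Arguments.
Unset Strict Implicit.
Unset Printing Implicit Defensive.

Import Order.TTheory GRing.Theory Num.Theory.
Local Open Scope classical_set_scope.
Local Open Scope ring_scope.

Section Graphs.
Variable V : choiceType.
Implicit Types (e : rel V) (A : set V) (u v x y : V).

(* The subgraph induced by A in the graph with adjacency e is connected: A is
   nonempty and any two vertices of A are joined by a walk staying inside A. *)
Definition connected_on e A : Prop :=
  A !=set0 /\
  forall x y, A x -> A y ->
    exists p : seq V, [/\ path e x p, last x p = y & forall z, z \in p -> A z].

Definition connected_graph e : Prop :=
  [/\ symmetric e, irreflexive e & connected_on e [set: V]].

Definition walk_of_length e x y (n : nat) : Prop :=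
  exists p : seq V, [/\ path e x p, last x p = y & size p = n].

(* Minimal length of a walk from x to y; the value 0 when there is none is
   never met in a connected graph. *)
Definition gdist e x y : nat :=
  if pselect (exists n, `[< walk_of_length e x y n >]) is left ex_walk
  then ex_minn ex_walk else 0%N.

Definition gsquare e : rel V :=
  fun u v => (u != v) && (gdist e u v <= 2)%N.

Definition ginterval e x y : set V :=
  [set w | (gdist e x w + gdist e w y)%N = gdist e x y].

Definition gconvex e A : Prop :=
  forall x y, A x -> A y -> ginterval e x y `<=` A.

(* Since distances are natural numbers, natural radii give all the balls. *)
Definition gball e v (r : nat) : set V := [set x | (gdist e v x <= r)%N].

Definition cb_graph e : Prop :=
  connected_graph e /\ forall v r, gconvex e (gball e v r).

Variable R : realType.
Implicit Types w : V -> R.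

Definition profile w : Prop :=
  (forall u, 0 <= w u) /\ finite_set [set u | w u != 0].

(* The sum over the whole vertex set is a genuine finite sum, because the
   profiles have finite support. *)
Definition medfun e w x : R :=
  \sum_(u \in [set: V]) w u * (gdist e u x)%:R.

Definition median e w : set V :=
  [set x | forall y, medfun e w x <= medfun e w y].

End Graphs.

(* Main.v *)
Require Import Defs.
From mathcomp Require Import all_boot all_order all_algebra.
From mathcomp Require Import all_classical all_reals.
From mathcomp Require Import zify lra.

(** Write d for the distance and F for the weighted distance sum of the
    profile. The theorem follows from a form of convexity of F: whenever
    d(u, v) > 2, some vertex x strictly between u and v satisfies F x < F u,
    or F x < F v, or F x = F u = F v (lemma peakless). If u and v are
    medians at distance greater than 2, then x is a median closer to both of
    them, and an induction on d(u, v) joins u to v by medians with jumps of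
    length at most 2.

    The heart of the matter is d(u, v) = 3. Then there are a geodesic u, a,
    b, v with F a + F b <= F u + F v (lemma wdist_lozenge3); in fact a and b
    can be chosen with d(o, a) + d(o, b) <= d(o, u) + d(o, v) for all o in
    the finite support. Convexity of the balls of centre o, say with d(o, u)
    <= d(o, v), gives d(o, a) <= d(o, u) + 1 and d(o, b) <= d(o, v), so that
    the inequality can only fail when both are equalities, that is when the
    distances to o along u, a, b, v are r, r+1, r+1, r+1 or r, r+1, r+2,
    r+2. In the first case there is a neighbour b' of v between u and v with
    d(o, b') <= r (low_last_step), and in the second a neighbour a' of u
    between u and v with d(o, a') <= r (low_first_step). An a adjacent to b'
    satisfies d(o, a) <= r by convexity, and a b adjacent to a' satisfies
    d(o, b) <= r + 1: so such an o imposes on (a, b) one adjacency with a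
    fixed vertex. Since two adjacent neighbours of u and two adjacent
    neighbours of v cannot form an induced square, the adjacency relation
    between the two sides is nested, and finitely many such constraints can
    be met at once (common_nbr_seq).

    The two low-step lemmas rest on two local consequences of the convexity
    of balls: the neighbours of x that are closer to o than x are pairwise
    adjacent (closer_adjacent), and two adjacent vertices at the same
    distance from o are the base of a triangle or of a pentagon pointing
    towards o, the pentagon going through a prescribed lower neighbour of
    one of the two (triangle_pentagon).

    Distance 4 is reduced to distance 3 by applying the inequality from the
    best neighbour of u to v and from u to the best neighbour of v;
    distances at least 5 follow by induction, by looking at a minimizer of F
    strictly between u and v. The minimizers exist although the graph may be
    infinite, since F takes only finitely many values below any bound. *)

Set Implicit Arguments.
Unset Strict Implicit.
Unset Printing Implicit Defensive.

Import Order.TTheory GRing.Theory Num.Theory.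

(** * The distance of a connected graph *)

Section Distance.
Variables (V : choiceType) (e : rel V).
Hypothesis conn_e : connected_graph e.
Implicit Types (o u v x y z : V).

Local Notation d := (gdist e).

Lemma adj_sym x y : e x y = e y x.
Proof. by case: conn_e => es _ _; exact: es. Qed.

Lemma adj_irr x : e x x = false.
Proof. by case: conn_e => _ ei _; exact: ei. Qed.

Lemma gdist_spec x y :
  walk_of_length e x y (d x y) /\
  forall n, walk_of_length e x y n -> d x y <= n.
Proof.
rewrite /gdist; case: pselect => [ex_walk|no_walk].
  case: ex_minnP => m /asboolP m_walk m_min; split=> // n n_walk.
  by apply: m_min; exact/asboolP.
case: conn_e => _ _ [_ /(_ x y I I) [p [p_path p_last _]]].
by case: no_walk; exists (size p); apply/asboolP; exists p.
Qed.

Lemma gdist_walk x y : walk_of_length e x y (d x y).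
Proof. by have [] := gdist_spec x y. Qed.

Lemma gdist_min x y n : walk_of_length e x y n -> d x y <= n.
Proof. by have [_] := gdist_spec x y; exact. Qed.

Lemma gdistxx x : d x x = 0.
Proof. by apply/eqP; rewrite -leqn0; apply: gdist_min; exists [::]. Qed.

Lemma gdist_triangle y x z : d x z <= d x y + d y z.
Proof.
have [p [p_path p_last <-]] := gdist_walk x y.
have [q [q_path q_last <-]] := gdist_walk y z.
apply: gdist_min; exists (p ++ q).
by rewrite cat_path last_cat size_cat p_path p_last q_path q_last.
Qed.

Lemma gdist_ladj_sym x y : d y x <= d x y.
Proof.
have [p [p_path p_last <-]] := gdist_walk x y.
apply: gdist_min; exists (rev (belast x p)); split.
- rewrite -p_last rev_path.
  by rewrite (eq_path (e' := e)) // => a b; rewrite adj_sym.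
- case: p {p_path} p_last => [/= ->//|a p _]; rewrite /= rev_cons.
  by rewrite last_rcons.
- by rewrite size_rev size_belast.
Qed.

Lemma gdistC x y : d x y = d y x.
Proof. by apply/eqP; rewrite eqn_leq !gdist_ladj_sym. Qed.

Lemma gdist0 x y : d x y = 0 -> x = y.
Proof.
have [p [_ p_last p_size]] := gdist_walk x y => d0; move: p_size p_last.
by rewrite d0; case: p.
Qed.

Lemma edge_gdist x y : e x y -> d x y = 1.
Proof.
move=> exy; have : d x y <= 1.
  by apply: gdist_min; exists [:: y]; split=> //=; rewrite exy.
have [d0|] := posnP (d x y); last by lia.
by move: exy; rewrite (gdist0 d0) adj_irr.
Qed.

Lemma gdist1 x y : d x y = 1 -> e x y.
Proof.
have [p [+ + p_size]] := gdist_walk x y => + + d1; move: p_size; rewrite d1.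
by case: p => [|a [|b p]] //= _; rewrite andbT => + <-.
Qed.

Lemma gdist_mid x y i : i <= d x y ->
  exists z, d x z = i /\ d z y = d x y - i.
Proof.
move=> i_le; have [p [p_path p_last p_size]] := gdist_walk x y.
have := p_path; rewrite -{1}(cat_take_drop i p) cat_path => /andP[p1 p2].
exists (last x (take i p)).
have le1 : d x (last x (take i p)) <= i.
  apply: gdist_min; exists (take i p); split=> //.
  by rewrite size_takel // p_size.
have le2 : d (last x (take i p)) y <= d x y - i.
  apply: gdist_min; exists (drop i p); split=> //.
    by rewrite -last_cat cat_take_drop.
  by rewrite size_drop p_size.
have := gdist_triangle (last x (take i p)) x y; lia.
Qed.

Lemma gdist_step x y : 0 < d x y -> exists z, e x z /\ d z y = (d x y).-1.
Proof.
by case/gdist_mid=> z [d1 d2]; exists z; rewrite d2 subn1 gdist1.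
Qed.

Lemma common_neighbor x y : d x y = 2 -> exists z, e x z /\ e z y.
Proof.
move=> d2; have [|z [exz dz]] := @gdist_step x y; first by rewrite d2.
by exists z; split=> //; apply: gdist1; rewrite dz d2.
Qed.

Lemma edge_level o x y : e x y -> d o x <= (d o y).+1.
Proof.
move=> exy; have := gdist_triangle y o x.
by rewrite (gdistC y x) (edge_gdist exy) addn1.
Qed.

Lemma gdist_path2 y x z : e x y -> e y z -> d x z <= 2.
Proof.
move=> exy eyz; have := gdist_triangle y x z.
by rewrite (edge_gdist exy) (edge_gdist eyz).
Qed.

End Distance.

(** * Local consequences of the convexity of balls *)

(** Solves linear goals on distances. The adjacency hypotheses are cleared
    because lia would treat each of them as a boolean unknown and branch on
    it. *)
Ltac dist_lia :=
  repeat match goal with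
  | H : is_true (?r _ _) |- _ => is_var r; clear H
  | H : is_true (~~ ?r _ _) |- _ => is_var r; clear H
  | H : ~ _ |- _ => clear H
  | H : exists _, _ |- _ => clear H
  end; lia.

Section ConvexBalls.
Variables (V : choiceType) (e : rel V).
Hypothesis cb_e : cb_graph e.
Implicit Types (o p q r s t u v w x y z a b c : V).

Local Notation d := (gdist e).
Let conn_e : connected_graph e := proj1 cb_e.
Let eC := adj_sym conn_e.
Let dC := gdistC conn_e.
Let level o x y : e x y -> d o x <= (d o y).+1 := @edge_level V e conn_e o x y.

Ltac sym := by [|rewrite eC].

Lemma gdist_between o x y w :
  d x w + d w y = d x y -> d o w <= maxn (d o x) (d o y).
Proof.
move=> betw; case: cb_e => _ /(_ o (maxn (d o x) (d o y)) x y) cvx.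
by apply: cvx; rewrite /gball /= ?leq_maxl ?leq_maxr.
Qed.

Lemma gdist_between_nbr o a b w : e a w -> d w b < d a b ->
  d o w <= maxn (d o a) (d o b).
Proof.
move=> eaw dwb; apply: gdist_between; rewrite (edge_gdist conn_e eaw).
have := gdist_triangle conn_e w a b; rewrite (edge_gdist conn_e eaw).
by dist_lia.
Qed.

Lemma nonadjacent_gdist2 u a b : e u a -> e u b -> a <> b -> ~~ e a b ->
  d a b = 2.
Proof.
rewrite eC => eau eub ab nab; have := gdist_path2 conn_e eau eub.
case dab: (d a b) => [|[|[|]]] // _; first by case: ab; apply: gdist0 dab.
by rewrite (gdist1 conn_e dab) in nab.
Qed.

(** If a and b were not adjacent, then u would lie between them, although
    the ball of centre o and radius d(o, u) - 1 contains a and b but not u. *)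
Lemma closer_adjacent o u a b : e u a -> e u b ->
  d o a < d o u -> d o b < d o u -> a = b \/ e a b.
Proof.
move=> eua eub da db; have [->|/eqP ab] := eqVneq a b; first by left.
right; apply: contraT => nab; have dab := nonadjacent_gdist2 eua eub ab nab.
have : d o u <= maxn (d o a) (d o b).
  apply: gdist_between; rewrite dab (edge_gdist conn_e eub) dC.
  by rewrite (edge_gdist conn_e eua).
by dist_lia.
Qed.

Lemma lower_neighbor o x n : d o x = n.+1 -> exists z, e x z /\ d o z = n.
Proof.
move=> dx; have [|z [exz dz]] := @gdist_step _ _ conn_e x o.
  by rewrite dC dx.
by exists z; rewrite dC dz dC dx.
Qed.

(** Let z' be a lower neighbour of y. Without a triangle on xy, the vertices
    z and z' are at distance 2, so they have a common neighbour w, and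
    convexity keeps w within level n. A w at level n - 1 completes the
    pentagon; a w at level n yields two edges zw and wz' on level n, to
    which the induction hypothesis applies. Unless some lower neighbour of z
    is within distance 2 of y, the triangles and pentagons obtained there
    contradict closer_adjacent. *)
Lemma triangle_pentagon n : forall o x y z, e x y -> e x z ->
  d o x = n.+1 -> d o y = n.+1 -> d o z = n ->
  (exists t, [/\ e x t, e y t & d o t = n]) \/
  (exists t w, [/\ e y t, e t w, e w z, d o t = n & (d o w).+1 = n]).
Proof.
elim: n => [|n IHn] o x y z exy exz dx dy dz.
  left; exists z; split=> //; apply: (gdist1 conn_e).
  by rewrite -(gdist0 conn_e dz) dC.
have [|no_tri] := pselect (exists t, [/\ e x t, e y t & d o t = n.+1]).
  by left.
right; have [z' [eyz' dz']] := lower_neighbor dy.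
have zz' : z <> z'.
  by move=> zz'; case: no_tri; exists z; split=> //; rewrite zz'.
have nxz' : ~~ e x z' by apply/negP => exz'; case: no_tri; exists z'.
have dxz' : d x z' = 2.
  apply: (@nonadjacent_gdist2 y) => //; first by rewrite eC.
  by move=> xz'; rewrite xz' dz' in dx; dist_lia.
have dzz'_gt1 : 1 < d z z'.
  case dzz': (d z z') => [|[|]] //; first by case: zz'; apply: gdist0 dzz'.
  have [yz|eyz] : y = z \/ e y z.
  - apply: (@closer_adjacent z' x) => //.
    + by rewrite dC (edge_gdist conn_e eyz') dC dxz'.
    + by rewrite dC dzz' dC dxz'.
  - by rewrite yz dz in dy; dist_lia.
  - by case: no_tri; exists z.
have dzz' : d z z' = 2.
  have := gdist_triangle conn_e x z z'.
  rewrite (dC z x) (edge_gdist conn_e exz) dxz'.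
  have [d3|] := ltnP 2 (d z z'); last by dist_lia.
  have : d o x <= maxn (d o z) (d o z').
    by apply: (@gdist_between_nbr _ z z') => //; rewrite 1?eC // dxz'.
  by dist_lia.
have [w [ezw ewz']] := common_neighbor conn_e dzz'.
have dw_le : d o w <= maxn (d o z) (d o z').
  by apply: gdist_between_nbr => //; rewrite dzz' (edge_gdist conn_e ewz').
have dw_ge := level o ezw.
have [dw|dw_ne] := eqVneq (d o w) n.
  by exists z', w; split=> //; rewrite 1?eC ?dw.
have {dw_le dw_ge dw_ne} dw : d o w = n.+1 by dist_lia.
(* Any neighbour p of z one level down and within distance 2 of y closes a
   pentagon, so all such p may be assumed to be at distance 3 from y. *)
have [|far_y] := pselect (exists p, [/\ e z p, d o p = n & d y p <= 2]).
  move=> [p [ezp dp dyp]].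
  have dyp2 : d y p = 2.
    have := gdist_triangle conn_e p o y; rewrite (dC p y); dist_lia.
  have [h [eyh ehp]] := common_neighbor conn_e dyp2.
  have := level o eyh; have := level o ehp.
  by exists h, p; split=> //; rewrite 1?eC //; dist_lia.
have far_z' p : e z p -> d o p = n -> 2 < d z' p.
  move=> ezp dp; rewrite ltnNge; apply/negP => dz'p.
  have dyp : 2 < d y p.
    by rewrite ltnNge; apply/negP => ?; case: far_y; exists p.
  have [xz'|exz'] : x = z' \/ e x z'.
  - apply: (@closer_adjacent p y) => //; rewrite 1?eC ?(dC p) //.
    + by have := gdist_path2 conn_e exz ezp; dist_lia.
    + by dist_lia.
  - by rewrite xz' dz' in dx; dist_lia.
  - by rewrite exz' in nxz'.
have far_r p r : e z p -> d o p = n -> e p r -> (d o r).+1 = n -> 2 < d z' r.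
  move=> ezp dp epr dr; rewrite ltnNge; apply/negP => dz'r.
  have := far_z' p ezp dp => dz'p.
  have [zr|ezr] : z = r \/ e z r.
  - apply: (@closer_adjacent z' p) => //; rewrite 1?eC //.
    + by rewrite dC dzz'.
    + by dist_lia.
  - by rewrite zr in dz; dist_lia.
  - by have := level o ezr; dist_lia.
have no_tri_zw p : e z p -> e w p -> d o p = n -> False.
  move=> ezp ewp dp; have := far_z' p ezp dp.
  by have := @gdist_path2 _ _ conn_e w z' p; rewrite eC ewz' ewp; dist_lia.
have no_tri_wz' t : e w t -> e z' t -> d o t = n -> False.
  move=> ewt ez't dt; have ewz : e w z by rewrite eC.
  have [[p [ewp ezp dp]]|[p [r [ezp epr ert dp dr]]]]
      := IHn o w z t ewz ewt dw dz dt.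
    exact: (no_tri_zw p).
  have := far_r p r ezp dp epr dr.
  by have := @gdist_path2 _ _ conn_e t z' r; rewrite ez't (eC t) ert; dist_lia.
have [q [ewq dq]] := lower_neighbor dw.
have ewz : e w z by rewrite eC.
have [[p [ewp ezp dp]]|[p [r [ezp epr erq dp dr]]]]
    := IHn o w z q ewz ewq dw dz dq.
  by case: (no_tri_zw p).
have [[t [ewt ez't dt]]|[q' [r' [ez'q' eq'r' er'q dq' dr']]]] :=
    IHn o w z' q ewz' ewq dw dz' dq.
  by case: (no_tri_wz' t).
have dz'r := far_r p r ezp dp epr dr.
have [rr'|err'] : r = r' \/ e r r'.
  by apply: (@closer_adjacent o q) => //; rewrite 1?eC //; dist_lia.
  by subst r'; have := gdist_path2 conn_e ez'q' eq'r'; dist_lia.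
have [wq'|ewq'] : w = q' \/ e w q'.
  apply: (@closer_adjacent r z') => //; rewrite 1?eC // ?(dC r).
    by have := @gdist_path2 _ _ conn_e q w r; rewrite ewq (eC q) erq; dist_lia.
  have := @gdist_path2 _ _ conn_e r' q' r.
  by rewrite eq'r' (eC r') err'; dist_lia.
  by rewrite wq' dq' in dw; dist_lia.
by case: (no_tri_wz' q').
Qed.

(** * Geodesics of length three *)

Let path2 y x z : e x y -> e y z -> d x z <= 2 := @gdist_path2 V e conn_e y x z.
Let closer o u a b := @closer_adjacent o u a b.

Lemma geodesic3 u v a b : d u v = 3 -> e u a -> e a b -> e b v ->
  d v a = 2 /\ d u b = 2.
Proof.
move=> duv eua eab ebv.
have := path2 eua eab; have := path2 eab ebv.
have := gdist_triangle conn_e a u v; have := gdist_triangle conn_e b u v.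
rewrite (edge_gdist conn_e eua) (edge_gdist conn_e ebv) (dC v); dist_lia.
Qed.

Lemma no_common_neighbor3 u v s : d u v = 3 -> e u s -> e s v -> False.
Proof. by move=> duv eus esv; have := path2 eus esv; rewrite duv. Qed.

(** A pentagon on bv through a already contains such an s. A triangle bvy
    has y adjacent to a, and then the third vertex of a triangle on ay is
    such an s. A pentagon a, y, z, t, u with lowest vertex t is not induced:
    its vertices u and z are neighbours of t closer to b, which is at
    distance 3 from t, so u and z are adjacent and z is the required
    vertex. *)
Lemma low_first_step o u v a b : d u v = 3 -> e u a -> e a b -> e b v ->
  d o a = (d o u).+1 -> d o b = (d o u).+2 -> d o v = (d o u).+2 ->
  exists s, [/\ e u s, d v s = 2 & d o s <= d o u].
Proof.
move=> duv eua eab ebv da db dv.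
have [dva dub] := geodesic3 duv eua eab ebv.
have inA s t : e u s -> e s t -> e t v -> d o s <= d o u ->
    exists s, [/\ e u s, d v s = 2 & d o s <= d o u].
  by move=> eus est etv ds; exists s; have [] := geodesic3 duv eus est etv.
have eba : e b a by sym.
have [[y [eby evy dy]]|[z [t [evz ezt eta dz dt]]]] :=
    triangle_pentagon ebv eba db dv da.
- have eay : e a y.
    have [ay|//] : a = y \/ e a y by apply: (@closer o b) => //; dist_lia.
    by move: evy; rewrite -ay => /(edge_gdist conn_e); rewrite dva.
  have eau : e a u by sym.
  have [[s [eas eys ds]]|[z [t [eyz ezt etu dz dt]]]] :=
      triangle_pentagon eay eau da dy erefl.
    have [us|eus] : u = s \/ e u s by apply: (@closer o a) => //; dist_lia.
      by case: (@no_common_neighbor3 u v y) => //; [rewrite us; sym|sym].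
    by apply: (inA s y) => //; [sym|sym|rewrite ds].
  have dbt : 2 < d b t.
    by have := gdist_triangle conn_e t o b; rewrite (dC t b); dist_lia.
  have [uz|euz] : u = z \/ e u z.
    apply: (@closer b t) => //; first by sym.
      by rewrite dC dub.
    by have := path2 eby eyz; dist_lia.
    by case: (@no_common_neighbor3 u v y) => //; [rewrite uz; sym|sym].
  by apply: (inA z y) => //; [sym|sym|rewrite dz].
- have [tu|etu] : t = u \/ e t u.
    by apply: (@closer o a) => //; first [sym|dist_lia].
  + by case: (@no_common_neighbor3 u v z) => //; [rewrite -tu; sym|sym].
  + by apply: (inA t z) => //; [sym|sym|sym|dist_lia].
Qed.

(** The case where the edge ab is the base of a triangle abc pointing
    towards o. Then bv carries a triangle or a pentagon through c, and in
    both cases the new neighbour of v is at distance 2 from u. *)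
Lemma low_last_step_aux o u v a b c : d u v = 3 ->
  e u a -> e a b -> e b v -> e u c -> e c b ->
  d o a = (d o u).+1 -> d o b = (d o u).+1 -> d o v = (d o u).+1 ->
  d o c = d o u ->
  exists s, [/\ e v s, d u s = 2 & d o s <= d o u].
Proof.
move=> duv eua eab ebv euc ecb da db dv dc.
have [dva dub] := geodesic3 duv eua eab ebv.
have [dvc _] := geodesic3 duv euc ecb ebv.
have ebc : e b c by sym.
have [[y [eby evy dy]]|[z [t [evz ezt etc dz dt]]]] :=
    triangle_pentagon ebv ebc db dv dc.
- have ecy : e c y.
    have [cy|//] : c = y \/ e c y by apply: (@closer o b) => //; dist_lia.
    by move: evy; rewrite -cy => /(edge_gdist conn_e); rewrite dvc.
  have eyv : e y v by sym.
  by exists y; have [_ ->] := geodesic3 duv euc ecy eyv; split; rewrite ?dy.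
have duz_ge : 2 <= d u z.
  have := gdist_triangle conn_e z u v.
  by rewrite duv (dC z) (edge_gdist conn_e evz); dist_lia.
have [duz|duz] := leqP (d u z) 2.
  by exists z; split; rewrite ?dz //; dist_lia.
have eac : e a c.
  have [ac|//] : a = c \/ e a c.
    by apply: (@closer v u) => //; rewrite (dC v u); dist_lia.
  by move: da; rewrite ac dc; dist_lia.
have ect : e c t by sym.
have etz : e t z by sym.
have daz : d a z = 2.
  apply/eqP; rewrite eqn_leq; apply/andP; split; last first.
    have := gdist_triangle conn_e a u z.
    by rewrite (edge_gdist conn_e eua); dist_lia.
  rewrite leqNgt; apply/negP => daz.
  have [tv|etv] : t = v \/ e t v.
    apply: (@closer a z) => //; first by sym.
      by have := path2 eac ect; dist_lia.
    by have := path2 eab ebv; dist_lia.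
    by move: dt; rewrite tv; dist_lia.
  by have := level o (y := t) (x := v); rewrite eC etv => /(_ isT); dist_lia.
have [s [eas esz]] := common_neighbor conn_e daz.
have est : e s t.
  have [st|//] : s = t \/ e s t.
    apply: (@closer u z) => //; first by sym.
      by have := path2 eua eas; dist_lia.
    by have := path2 euc ect; dist_lia.
  by have := level o eas; rewrite st; dist_lia.
have ds : d o s < d o a by have := level o est; dist_lia.
have [us|eus] : u = s \/ e u s by apply: (@closer o a) => //; [sym|dist_lia].
- by move: duz; rewrite us (edge_gdist conn_e esz).
- by have := path2 eus esz; dist_lia.
Qed.

(** A triangle on ab is the situation of the preceding lemma. Otherwise
    there is a pentagon a, b, z, t, u, and then either z is adjacent to v or
    bv is the base of a triangle or a pentagon through z, which contains a
    lower neighbour y of v. If y is not at distance 2 from u, then the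
    triangle makes a and t two neighbours of u closer to y, which is
    impossible as their levels differ by 2, and the pentagon provides a
    triangle on ab after all. *)
Lemma low_last_step o u v a b : d u v = 3 -> e u a -> e a b -> e b v ->
  d o a = (d o u).+1 -> d o b = (d o u).+1 -> d o v = (d o u).+1 ->
  exists s, [/\ e v s, d u s = 2 & d o s <= d o u].
Proof.
move=> duv eua eab ebv da db dv.
have [dva dub] := geodesic3 duv eua eab ebv.
have inB s : e v s -> d u s <= 2 -> d o s <= d o u ->
    exists s, [/\ e v s, d u s = 2 & d o s <= d o u].
  move=> evs dus ds; exists s; split=> //; have := gdist_triangle conn_e s u v.
  by rewrite (dC s) (edge_gdist conn_e evs); dist_lia.
have eau : e a u by sym.
have [[c [eac ebc dc]]|[z [t [ebz ezt etu dz dt]]]] :=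
    triangle_pentagon eab eau da db erefl.
  have [uc|euc] : u = c \/ e u c by apply: (@closer o a) => //; dist_lia.
    by move: ebc; rewrite -uc => /(edge_gdist conn_e); rewrite dC dub.
  by apply: (@low_last_step_aux o u v a b c) => //; sym.
have eut : e u t by sym.
have etz : e t z by sym.
have neat : ~ (a = t \/ e a t).
  by move=> [at_|eat]; [move: dt; rewrite -at_|have := level o eat]; dist_lia.
have duz := path2 eut etz.
have [evz|nevz] := boolP (e v z); first by apply: (inB z); rewrite ?dz.
have [[y [eby evy dy]]|[y [t' [evy eyt' et'z dy dt']]]] :=
    triangle_pentagon ebv ebz db dv dz.
  have [duy|duy] := leqP (d u y) 2; first by apply: (inB y); rewrite ?dy.
  have ezy : e z y.
    have [zy|//] : z = y \/ e z y by apply: (@closer o b) => //; dist_lia.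
    by move: nevz; rewrite zy evy.
  case: neat; apply: (@closer y u) => //; rewrite (dC y u) (dC y).
    by have := path2 eab eby; dist_lia.
  by have := path2 etz ezy; dist_lia.
have [duy|duy] := leqP (d u y) 2; first by apply: (inB y); rewrite ?dy.
have et'y : e t' y by sym.
have [tt'|ett'] : t = t' \/ e t t'.
  by apply: (@closer o z) => //; first [sym|dist_lia].
  by move: duy; rewrite -tt' in et'y; have := path2 eut et'y; dist_lia.
have day : 2 < d y a.
  rewrite ltnNge; apply/negP => dya; case: neat.
  apply: (@closer y u) => //; rewrite (dC y u); first by dist_lia.
  by have := path2 ett' et'y; rewrite (dC y); dist_lia.
have dat' : d a t' = 2.
  have da2 : 2 <= d a t'.
    by have := gdist_triangle conn_e t' o a; rewrite (dC t'); dist_lia.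
  apply/eqP; rewrite eqn_leq da2 andbT leqNgt; apply/negP => dat'.
  have [ub|eub] : u = b \/ e u b.
    apply: (@closer t' a) => //; rewrite ?(dC t').
      by have := path2 eut ett'; dist_lia.
    by have := @path2 z b t' ebz; rewrite eC => /(_ et'z); dist_lia.
    by move: db; rewrite -ub; dist_lia.
  by have := edge_gdist conn_e eub; rewrite dub.
have [c [eac ect']] := common_neighbor conn_e dat'.
have dc : d o c = d o u.
  by have := level o eac; have := level o ect'; dist_lia.
have euc : e u c.
  have [uc|//] : u = c \/ e u c by apply: (@closer o a) => //; dist_lia.
  by move: duy; rewrite uc; have := path2 ect' et'y; dist_lia.
have [cb|ecb] : c = b \/ e c b.
  apply: (@closer y a) => //; rewrite (dC y).
    by have := path2 ect' et'y; dist_lia.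
  by have := path2 ebv evy; dist_lia.
  by move: dc; rewrite cb; dist_lia.
exact: (@low_last_step_aux o u v a b c).
Qed.

Lemma geodesic3_exists u v : d u v = 3 ->
  exists a b, [/\ e u a, e a b & e b v].
Proof.
move=> duv; have [|a [eua dav]] := @gdist_step _ _ conn_e u v.
  by rewrite duv.
rewrite duv in dav; have [b [eab ebv]] := common_neighbor conn_e dav.
by exists a, b.
Qed.

(** For a given o at most one of the two adjacency conditions matters: the
    one with b0 if the distances to u and v differ by 1, the one with a0 if
    they differ by 2; the other vertex is arbitrary. *)
Lemma lozenge_witnesses_le o u v : d u v = 3 -> d o u <= d o v ->
  exists a0 b0, [/\ e u a0, d v a0 = 2, e v b0, d u b0 = 2 &
    forall a b, e u a -> e a b -> e b v -> e a b0 -> e b a0 ->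
      d o a + d o b <= d o u + d o v].
Proof.
move=> duv ouv; have [a1 [b1 [eua1 eab1 ebv1]]] := geodesic3_exists duv.
have [dva1 dub1] := geodesic3 duv eua1 eab1 ebv1.
have evb1 : e v b1 by sym.
have [|no_bad] := pselect (exists a b,
    [/\ e u a, e a b, e b v & d o u + d o v < d o a + d o b]); last first.
  exists a1, b1; split=> // a b eua eab ebv _ _.
  by rewrite leqNgt; apply/negP => bad; case: no_bad; exists a, b.
move=> [a [b [eua eab ebv bad]]].
have [dva dub] := geodesic3 duv eua eab ebv.
have evb : e v b by sym.
have a_le : d o a <= maxn (d o u) (d o v).
  by apply: (@gdist_between_nbr o) => //; rewrite dC dva duv.
have b_le x : e v x -> d u x = 2 -> d o x <= d o v.
  move=> evx dux; have : d o x <= maxn (d o v) (d o u).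
    by apply: (@gdist_between_nbr o) => //; rewrite dC dux dC duv.
  by dist_lia.
have := b_le b evb dub; have := level o eab.
have eau : e a u by sym.
have := level o eau; have eba : e b a by sym.
have := level o eba => lev1 lev2 lev3 b_le0.
have [dv|dv] := eqVneq (d o v) (d o u).+1.
  have [||b0 [evb0 dub0 db0]] := low_last_step duv eua eab ebv _ _ dv.
    by dist_lia.
    by dist_lia.
  exists a1, b0; split=> // a' b' eua' eab' ebv' ea'b0 _.
  have [_ dub'] := geodesic3 duv eua' eab' ebv'.
  have evb' : e v b' by sym.
  have := b_le b' evb' dub'.
  have : d o a' <= maxn (d o u) (d o b0).
    apply: (@gdist_between_nbr o) => //.
    by rewrite dub0 (edge_gdist conn_e ea'b0).
  by dist_lia.
have [|||a0 [eua0 dva0 da0]] := low_first_step duv eua eab ebv (o := o).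
  by dist_lia.
  by dist_lia.
  by dist_lia.
exists a0, b1; split=> // a' b' eua' _ _ _ eb'a0.
have := level o eb'a0; have ea'u : e a' u by sym.
by have := level o ea'u; dist_lia.
Qed.

Lemma lozenge_witnesses o u v : d u v = 3 ->
  exists a0 b0, [/\ e u a0, d v a0 = 2, e v b0, d u b0 = 2 &
    forall a b, e u a -> e a b -> e b v -> e a b0 -> e b a0 ->
      d o a + d o b <= d o u + d o v].
Proof.
move=> duv; have [ouv|vou] := leqP (d o u) (d o v).
  exact: lozenge_witnesses_le.
have dvu : d v u = 3 by rewrite dC.
have [a0 [b0 [eva0 dua0 eub0 dvb0 good]]] :=
  lozenge_witnesses_le dvu (ltnW vou).
exists b0, a0; split=> // a b eua eab ebv eaa0 ebb0.
by rewrite addnC [leqRHS]addnC; apply: good => //; sym.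
Qed.

(** If a1 serves the tail of the list but is not adjacent to b, then any a2
    between u and b serves the whole list: a1, a2, b, b' cannot form an
    induced square. *)
Lemma common_nbr_seq u v (bs : seq V) : d u v = 3 ->
  (forall b, b \in bs -> e v b /\ d u b = 2) ->
  exists a, [/\ e u a, d v a = 2 & forall b, b \in bs -> e a b].
Proof.
move=> duv; elim: bs => [_|b bs IHbs in_bs].
  have [a [b [eua eab ebv]]] := geodesic3_exists duv.
  by exists a; split=> //; have [] := geodesic3 duv eua eab ebv.
have [|a1 [eua1 dva1 a1_bs]] := IHbs.
  by move=> b' b'_bs; apply: in_bs; rewrite inE b'_bs orbT.
have [evb dub] : e v b /\ d u b = 2 by apply: in_bs; rewrite mem_head.
have [ea1b|nea1b] := boolP (e a1 b).
  by exists a1; split=> // b'; rewrite inE => /predU1P[->|/a1_bs].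
have [a2 [eua2 ea2b]] := common_neighbor conn_e dub.
have ebv : e b v by sym.
have [dva2 _] := geodesic3 duv eua2 ea2b ebv.
have ea1a2 : e a1 a2.
  have [a12|//] : a1 = a2 \/ e a1 a2.
    by apply: (@closer v u) => //; rewrite (dC v u) duv ?dva1 ?dva2.
  by rewrite a12 ea2b in nea1b.
exists a2; split=> // b'; rewrite inE => /predU1P[->//|b'_bs].
have [evb' dub'] : e v b' /\ d u b' = 2.
  by apply: in_bs; rewrite inE b'_bs orbT.
have ebb' : e b b'.
  have [bb'|//] : b = b' \/ e b b'.
    by apply: (@closer u v) => //; rewrite duv ?dub ?dub'.
  by move: nea1b; rewrite bb' a1_bs.
have dba1 : 1 < d b a1.
  rewrite (dC b); case da1b: (d a1 b) => [|[|]] //.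
    by move: (edge_gdist conn_e eua1); rewrite (gdist0 conn_e da1b) dub.
  by move: nea1b; rewrite (gdist1 conn_e da1b).
have [a2b'|//] : a2 = b' \/ e a2 b'.
  apply: (@closer b a1) => //; first exact: a1_bs.
    by rewrite dC (edge_gdist conn_e ea2b).
  by rewrite (edge_gdist conn_e ebb').
by move: dub'; rewrite -a2b' (edge_gdist conn_e eua2).
Qed.

Lemma lozenge3 u v (X : seq V) : d u v = 3 ->
  exists a b, [/\ e u a, d v a = 2, e v b, d u b = 2 &
    forall o, o \in X -> d o a + d o b <= d o u + d o v].
Proof.
move=> duv; have dvu : d v u = 3 by rewrite dC.
have /choice[f f_good] : forall o, exists p : V * V,
    [/\ e u p.1, d v p.1 = 2, e v p.2, d u p.2 = 2 &
    forall a b, e u a -> e a b -> e b v -> e a p.2 -> e b p.1 ->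
      d o a + d o b <= d o u + d o v].
  by move=> o; have [a0 [b0 good]] := lozenge_witnesses o duv; exists (a0, b0).
have [|a [eua dva a_bs]] := @common_nbr_seq u v [seq (f o).2 | o <- X] duv.
  by move=> _ /mapP[o _ ->]; have [] := f_good o.
have [|b [evb dub b_as]] :=
    @common_nbr_seq v u (a :: [seq (f o).1 | o <- X]) dvu.
  move=> a'; rewrite inE => /predU1P[->//|/mapP[o _ ->]].
  by have [] := f_good o.
exists a, b; split=> // o oX; have [_ _ _ _ good] := f_good o.
apply: good => //; [rewrite eC|rewrite eC| |].
- exact: b_as (mem_head _ _).
- exact: evb.
- by apply: a_bs; apply/mapP; exists o.
- by apply: b_as; rewrite inE; apply/orP; right; apply/mapP; exists o.
Qed.

End ConvexBalls.

Local Open Scope ring_scope.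

(** * Weighted distance sums *)

Section WeightedDistance.
Variables (R : realType) (V : choiceType) (e : rel V).
Variables (X : seq V) (w : V -> R).
Hypothesis w_ge0 : forall o, 0 <= w o.
Implicit Types (o u v x y z a b c : V).

Local Notation d := (gdist e).

Definition wdist x : R := \sum_(o <- X) w o * (d o x)%:R.

Lemma wdist_pair u v a b :
  (forall o, o \in X -> (d o a + d o b <= d o u + d o v)%N) ->
  wdist a + wdist b <= wdist u + wdist v.
Proof.
move=> le_uv; rewrite /wdist -!big_split /= big_seq [leRHS]big_seq.
apply: ler_sum => o oX; rewrite -!mulrDr ler_wpM2l //.
by rewrite -!natrD ler_nat le_uv.
Qed.

(** Below a fixed bound M the value of the sum depends on finitely many
    bounded natural numbers, so a minimum over a finite type gives the
    minimizer. *)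
Lemma wdist_attains_min (S : V -> Prop) : (exists x, S x) ->
  exists x, S x /\ forall y, S y -> wdist x <= wdist y.
Proof.
move=> [s0 Ss0]; pose M := wdist s0.
have M_ge0 : 0 <= M by apply: sumr_ge0 => o _; rewrite mulr_ge0.
pose N := \max_(o <- X) Num.bound (M / w o).
have N_bound o x : o \in X -> w o != 0 -> wdist x <= M -> (d o x <= N)%N.
  move=> oX wo_neq0 xM; have wo_gt0 : 0 < w o by rewrite lt_def wo_neq0 w_ge0.
  have le_wdist : w o * (d o x)%:R <= wdist x.
    rewrite /wdist (big_rem o) //= lerDl.
    by apply: sumr_ge0 => ? _; rewrite mulr_ge0.
  have : (d o x)%:R <= M / w o :> R.
    by rewrite ler_pdivlMr // mulrC; apply: le_trans xM.
  have Mw_ge0 : 0 <= M / w o by rewrite divr_ge0.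
  move=> /le_lt_trans/(_ (archi_boundP Mw_ge0)); rewrite ltr_nat => /ltnW.
  move=> /leq_trans; apply.
  exact: (@leq_bigmax_seq _ X xpredT (fun o => Num.bound (M / w o))).
pose n := size X; pose pt (i : 'I_n) := tnth (in_tuple X) i.
pose code x := [ffun i : 'I_n => inord (d (pt i) x) : 'I_N.+1].
pose val (g : {ffun 'I_n -> 'I_N.+1}) : R := \sum_i w (pt i) * (g i)%:R.
have val_code x : wdist x <= M -> wdist x = val (code x).
  move=> xM; rewrite /wdist big_tnth; apply: eq_bigr => i _; rewrite ffunE.
  have [->|wi_neq0] := eqVneq (w (pt i)) 0; first by rewrite !mul0r.
  by rewrite inordK // ltnS; apply: N_bound => //; exact: mem_tnth.
pose P g := `[< exists x, [/\ S x, wdist x <= M & code x = g] >].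
have P0 : P (code s0) by apply/asboolP; exists s0.
case: (@Order.TotalTheory.arg_minP _ R _ (code s0) P val P0).
move=> g /asboolP[x [Sx xM cx]] g_min.
exists x; split=> // y Sy; have [yM|My] := leP (wdist y) M; last first.
  exact: le_trans xM (ltW My).
rewrite (val_code _ xM) (val_code _ yM) cx; apply: g_min.
by apply/asboolP; exists y.
Qed.

End WeightedDistance.

(** * Convexity of weighted distance sums and the median set *)

Section Peakless.
Variables (R : realType) (V : choiceType) (e : rel V).
Hypothesis cb_e : cb_graph e.
Variables (X : seq V) (w : V -> R).
Hypothesis w_ge0 : forall o, 0 <= w o.
Implicit Types (o u v x y z a b c : V).

Local Notation d := (gdist e).
Local Notation F := (wdist e X w).
Let conn_e : connected_graph e := proj1 cb_e.
Let dC := gdistC conn_e.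

Definition inner u v x : Prop :=
  [/\ (d u x + d x v)%N = d u v, (0 < d u x)%N & (0 < d x v)%N].

Definition below u v x : Prop :=
  F x < F u \/ F x < F v \/ (F x = F u /\ F x = F v).

Lemma innerC u v x : inner u v x -> inner v u x.
Proof. by move=> [betw ux xv]; split; rewrite ?(dC v) ?(dC x u) // addnC. Qed.

Lemma inner_trans u v x y : inner u v x -> inner x v y ->
  inner u v y /\ (d u x < d u y)%N.
Proof.
move=> [b1 p1 q1] [b2 p2 q2]; have := gdist_triangle conn_e x u y.
have := gdist_triangle conn_e y u v => t1 t2.
by split; [split|]; lia.
Qed.

Lemma pair_below u v a b : inner u v a -> inner u v b ->
  F a + F b <= F u + F v -> exists x, inner u v x /\ below u v x.
Proof.
move=> in_a in_b Fab.
have [|na] := pselect (below u v a); first by exists a.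
have [|nb] := pselect (below u v b); first by exists b.
case: na; rewrite /below.
have [|ua] := ltP (F a) (F u); first by left.
have [|va] := ltP (F a) (F v); first by right; left.
have [?|ub] := ltP (F b) (F u); first by case: nb; left.
have [?|vb] := ltP (F b) (F v); first by case: nb; right; left.
by right; right; split; lra.
Qed.

Lemma wdist_lozenge3 u v : d u v = 3 ->
  exists a b, [/\ e u a, d v a = 2, e v b, d u b = 2 &
    F a + F b <= F u + F v].
Proof.
move=> duv; have [a [b [eua dva evb dub ab]]] := lozenge3 cb_e X duv.
by exists a, b; split=> //; apply: wdist_pair.
Qed.

Lemma peakless3 u v : d u v = 3 -> exists x, inner u v x /\ below u v x.
Proof.
move=> duv; have [a [b [eua dva evb dub]]] := wdist_lozenge3 duv.
have dua := edge_gdist conn_e eua; have dvb := edge_gdist conn_e evb.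
apply: pair_below; split;
  by rewrite ?duv ?(dC a v) ?(dC b v) ?dva ?dub ?dua ?dvb.
Qed.

(** Add the inequalities of two lozenges, one from the best neighbour a of u
    to v and one from u to the best neighbour b of v: the contributions of
    the first and third levels cancel in favour of two vertices of the
    middle level. *)
Lemma peakless4 u v : d u v = 4 -> exists x, inner u v x /\ below u v x.
Proof.
move=> duv; have min_at i : (i <= 4)%N -> exists a,
    (d u a = i /\ d v a = 4 - i)%N /\
    forall y, (d u y = i /\ d v y = 4 - i)%N -> F a <= F y.
  move=> i_le; apply: wdist_attains_min => //.
  have [|z [duz dzv]] := @gdist_mid _ _ conn_e u v i; first by rewrite duv.
  by exists z; rewrite (dC v) dzv duv.
have [//|a [[dua dva] a_min]] := min_at 1%N.
have [//|b [[dub dvb] b_min]] := min_at 3%N.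
have [|c [b' [eac dvc evb' dab' le1]]] := @wdist_lozenge3 a v.
  by rewrite dC dva.
have [a' [c' [eua' dba' ebc' duc' le2]]] := wdist_lozenge3 dub.
have dac := edge_gdist conn_e eac; have dvb' := edge_gdist conn_e evb'.
have dua' := edge_gdist conn_e eua'; have dbc' := edge_gdist conn_e ebc'.
have tri := gdist_triangle conn_e.
(* The outer vertices of the two lozenges lie on the levels of b and a. *)
have Fb : F b <= F b'.
  by apply: b_min; have := tri a u b'; have := tri b' u v; rewrite (dC b'); lia.
have Fa : F a <= F a'.
  apply: a_min; have := tri b v a'; have := tri a' u v.
  by rewrite (dC a' v); lia.
have inner_mid x : (d u x <= 2 -> d v x <= 2 -> inner u v x)%N.
  move=> ux vx; have := tri x u v.
  by rewrite (dC x) /inner (dC x) duv => ?; split; lia.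
apply: (@pair_below u v c c'); last by lra.
- by apply: inner_mid; have := tri a u c; lia.
- by apply: inner_mid; have := tri b v c'; lia.
Qed.

(** If no vertex qualifies, let y be a minimizer of F strictly between u and
    v, where F u <= F v. Applying the claim between u and a minimizer z
    shows that d(u, z) <= 2; applying it between z and v gives another
    minimizer further from u. Two such steps contradict the bound. *)
Lemma peakless u v : (2 < d u v)%N -> exists x, inner u v x /\ below u v x.
Proof.
have [n] := ubnP (d u v); elim: n u v => // n IHn u v duv_lt duv_gt2.
wlog Fuv : u v duv_lt duv_gt2 / F u <= F v.
  move=> Hwlog; have [Fuv|/ltW Fvu] := leP (F u) (F v); first exact: Hwlog.
  have [||x [/innerC in_x Fx]] := Hwlog v u _ _ Fvu; rewrite 1?dC //.
  by exists x; split=> //; case: Fx => [|[|[]]]; rewrite /below; tauto.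
have [/peakless3//|d3] := eqVneq (d u v) 3.
have [/peakless4//|d4] := eqVneq (d u v) 4.
have [//|none] := pselect (exists x, inner u v x /\ below u v x).
have F_ge x : inner u v x ->
    [/\ F u <= F x, F v <= F x & ~ (F x = F u /\ F x = F v)].
  move=> in_x; have nb : ~ below u v x by move=> bx; case: none; exists x.
  split; first by rewrite leNgt; apply/negP => ?; case: nb; left.
    by rewrite leNgt; apply/negP => ?; case: nb; right; left.
  by move=> ?; case: nb; right; right.
have [|y [in_y y_min]] := @wdist_attains_min R V e X w w_ge0 (inner u v).
  have [|z [duz dzv]] := @gdist_mid _ _ conn_e u v 1; first by lia.
  by exists z; split; lia.
have near_u z : inner u v z -> F z = F y -> (d u z <= 2)%N.
  move=> in_z Fz; rewrite leqNgt; apply/negP => uz.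
  have [|x [in_x bx]] := IHn u z _ uz; first by case: in_z; lia.
  have [in_x' _] := inner_trans (innerC in_z) (innerC in_x).
  have {}in_x' := innerC in_x'; have [ux vx _] := F_ge x in_x'.
  have yx := y_min x in_x'; have [_ vz nz] := F_ge z in_z.
  case: bx => [|[|[xu xz]]]; [lra|lra|].
  by apply: nz; split; lra.
have step z : inner u v z -> F z = F y ->
    exists z', [/\ inner u v z', F z' = F y & (d u z < d u z')%N].
  move=> in_z Fz; have uz := near_u z in_z Fz.
  have [||x [in_x bx]] := IHn z v; [by case: in_z; lia|by case: in_z; lia|].
  have [in_x' lt_x] := inner_trans in_z in_x; exists x; split=> //.
  have [ux vx _] := F_ge x in_x'; have yx := y_min x in_x'.
  by case: bx => [|[|[xz _]]]; lra.
have [y1 [in_y1 Fy1 yy1]] := step y in_y erefl.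
have [y2 [in_y2 Fy2 y1y2]] := step y1 in_y1 Fy1.
by have := near_u y2 in_y2 Fy2; case: in_y; lia.
Qed.

End Peakless.

Lemma medfun_wdist (R : realType) (V : choiceType) (e : rel V) (w : V -> R) :
  profile w -> exists X : seq V, forall x, medfun e w x = wdist e X w x.
Proof.
move=> [_ w_fin].
exists (finmap.enum_fset (fset_set [set u | w u != 0]%classic)) => x.
rewrite /medfun /wdist; apply: fsbigTE => u.
rewrite in_fset_set // notin_setE /= => /negP; rewrite negbK => /eqP ->.
by rewrite mul0r.
Qed.

Theorem theorem49 (R : realType) (V : choiceType) (e : rel V)
    (cb_e : cb_graph e) (w : V -> R) (w_profile : profile w) :
  connected_on (gsquare e) (median e w).
Proof.
have [X FX] := medfun_wdist e w_profile.
have [w_ge0 _] := w_profile; have conn_e := cb_e.1.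
have medE x : median e w x <-> forall y, wdist e X w x <= wdist e X w y.
  by split=> x_min y; have := x_min y; rewrite !FX.
split.
  have [|x [_ x_min]] := @wdist_attains_min R V e X w w_ge0 (fun=> True).
    by case: conn_e => _ _ [[x _] _]; exists x.
  by exists x; apply/medE => y; apply: x_min.
move=> u v; have [n] := ubnP (gdist e u v).
elim: n u v => // n IHn u v duv_lt med_u med_v.
have [duv|duv] := leqP (gdist e u v) 2.
  have [<-|uv] := eqVneq u v; first by exists [::].
  exists [:: v]; split=> //= [|z]; first by rewrite /gsquare uv duv.
  by rewrite inE => /eqP ->.
have [x [[betw ux xv] Fx]] := peakless cb_e X w_ge0 duv.
have /medE u_min := med_u; have /medE v_min := med_v.
have med_x : median e w x.
  apply/medE => y; apply: le_trans (u_min y).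
  by case: Fx => [|[|[->]]]; [move=> /ltW| |]; have := v_min u => //; lra.
have [|p [p_path p_last p_med]] := IHn u x _ med_u med_x; first by lia.
have [|q [q_path q_last q_med]] := IHn x v _ med_x med_v; first by lia.
exists (p ++ q); split.
- by rewrite cat_path p_path p_last.
- by rewrite last_cat p_last.
- by move=> z; rewrite mem_cat => /orP[/p_med|/q_med].
Qed.
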